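(* Let $H:\mathbb{R}^{2n}\to\mathbb{R}$ be a smooth function such that $f(x):=J_n^{-1}\nabla H(x)=Ax+c$ for all $x\in\mathbb{R}^{2n}$, with $A\in\mathbb{R}^{2n\times2n}$ and $c\in\mathbb{R}^{2n}$. Let $U\in\mathbb{R}^{2n\times2k}$ be symplectic, i.e. $U^TJ_nU=J_k$, and set $U^\dagger=J_k^{-1}U^TJ_n$ and $F=U^\dagger A U$. Let $h\in\mathbb{R}$ and let $x_-,x\in\mathbb{R}^{2n}$ be such that $x-x_-$ is in the range of $U$. Define $$x_+=x+U\,e^{hF}\,U^\dagger(x_--x)+2h\,U\,\phi(hF)\,U^\dagger f(x).$$ Then $$H\big(\tfrac12(x_++x)\big)=H\big(\tfrac12(x+x_-)\big).$$
   Context: For a positive integer $m$, $J_m=\begin{bmatrix}0&I_m\\-I_m&0\end{bmatrix}\in\mathbb{R}^{2m\times2m}$. The entire function $\phi$ is $\phi(z)=\int_0^1 e^{tz}\,dt=z^{-1}(e^z-1)$ (with $\phi(0)=1$), applied to square matrices through its power series. The scheme defining $x_+$ is the projected explicit exponential midpoint rule. *)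

(* Defs.v *)
From HB Require Import structures.
From mathcomp Require Import all_boot all_order all_algebra.
From mathcomp Require Import all_classical all_reals all_analysis.

Set Implicit Arguments.
Unset Strict Implicit.
Unset Printing Implicit Defensive.

Import Order.TTheory GRing.Theory Num.Theory.
Import numFieldNormedType.Exports.

Local Open Scope classical_set_scope.
Local Open Scope ring_scope.

Section Symplectic.
Context {R : realType}.

(* R^{2m} is 'cV[R]_(m + m), so that the block form of J_m typechecks as is. *)
Definition J (m : nat) : 'M[R]_(m + m) := block_mx 0 1%:M (- 1%:M) 0.

Definition symplectic (n k : nat) (U : 'M[R]_(n + n, k + k)) : Prop :=
  U^T *m J n *m U = J k.

Definition symp_inv (n k : nat) (U : 'M[R]_(n + n, k + k)) :
    'M[R]_(k + k, n + n) :=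
  invmx (J k) *m U^T *m J n.

End Symplectic.

Section Calculus.
Context {R : realType}.

Definition partial (d : nat) (i : 'I_d) (g : 'cV[R]_d -> R) : 'cV[R]_d -> R :=
  fun x => 'D_(delta_mx i 0) g x.

Definition gradient (d : nat) (g : 'cV[R]_d -> R) (x : 'cV[R]_d) : 'cV[R]_d :=
  \col_i partial i g x.

(* class C^r : all iterated partial derivatives of order at most r exist
   everywhere and are continuous *)
Fixpoint Cr (d r : nat) (g : 'cV[R]_d -> R) : Prop :=
  match r with
  | 0 => continuous g
  | r'.+1 => [/\ continuous g,
      forall (i : 'I_d) (x : 'cV[R]_d), derivable g x (delta_mx i 0) &
      forall i : 'I_d, Cr r' (partial i g)]
  end.

Definition smooth (d : nat) (g : 'cV[R]_d -> R) : Prop := forall r, Cr r g.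

Definition ham_field (n : nat) (H : 'cV[R]_(n + n) -> R) (x : 'cV[R]_(n + n)) :
    'cV[R]_(n + n) :=
  invmx (J n) *m gradient H x.

End Calculus.

Section MatrixFunctions.
Context {R : realType}.

(* The value at M of an entire function g (real on the real line, and given by
   its restriction to R) through its power series at 0. The limit is taken in
   'M[R]_d; [limn] is total, but the series converges for every M when g is
   entire. *)
Definition mxfun (g : R -> R) (d : nat) (M : 'M[R]_d) : 'M[R]_d :=
  limn (series (fun j : nat => (derive1n j g 0 / j`!%:R) *: M ^+ j)).

Definition phi (z : R) : R :=
  (\int[lebesgue_measure]_(t in `[0%R, 1%R]) expR (t * z))%R.

Definition expmx (d : nat) (M : 'M[R]_d) : 'M[R]_d := mxfun expR M.

Definition phimx (d : nat) (M : 'M[R]_d) : 'M[R]_d := mxfun phi M.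

End MatrixFunctions.

(* Main.v *)
(** Restricted to the affine space x + range U, the Hamiltonian is a quadratic
    polynomial [energy] whose Hamiltonian system is y' = F y + g, with
    g = (symp_inv U) f(x), and both midpoints lie in that space: they are x - U w / 2 and
    x + U (- e^{hF} w + 2 h phi(hF) g) / 2, where x - x_- = U w.  Since J F is
    symmetric, E = e^{hF} satisfies E^T J E = J and P = phi(hF) satisfies
    P^T J E = J phi(-hF) E = J P, so the form P^T J (E + 1) is alternating.
    Together with h F P = E - 1 these identities equate the energies of the two
    midpoints.

    The identities between E and P are identities between power series, whose
    matrix version rests on a Cauchy product theorem. *)
Require Import Defs.
From HB Require Import structures.
From mathcomp Require Import all_boot all_order all_algebra.
From mathcomp Require Import all_classical all_reals all_analysis.
From mathcomp Require Import ring lra.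
Set Implicit Arguments.
Unset Strict Implicit.
Unset Printing Implicit Defensive.
Import Order.TTheory GRing.Theory Num.Theory.
Import numFieldNormedType.Exports.
Local Open Scope ring_scope.

(** * Rearrangement of finite double sums *)

Section TriangleSum.
Context {V : zmodType}.
Implicit Types g : nat -> nat -> V.

Lemma sum_triangle g N :
  \sum_(0 <= i < N) \sum_(0 <= j < N - i) g i j =
  \sum_(0 <= m < N) \sum_(0 <= i < m.+1) g i (m - i)%N.
Proof.
elim: N => [|N IH]; first by rewrite !big_nil.
rewrite [RHS]big_nat_recr//= -IH.
rewrite (eq_big_nat _ _
  (F2 := fun i => \sum_(0 <= j < N - i) g i j + g i (N - i)%N)); last first.
  by move=> i /andP[_ iN]; rewrite subSn// big_nat_recr.
rewrite big_split/= [in X in X + _]big_nat_recr//=.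
by rewrite subnn [X in _ + X + _]big_geq// addr0.
Qed.

(** The excess of a product of two [N]-term partial sums over the [N]-term partial sum of their
    Cauchy product. *)
Definition corner_sum g N := \sum_(0 <= i < N) \sum_(N - i <= j < N) g i j.

Lemma sum_square g N :
  \sum_(0 <= i < N) \sum_(0 <= j < N) g i j =
  \sum_(0 <= m < N) \sum_(0 <= i < m.+1) g i (m - i)%N + corner_sum g N.
Proof.
rewrite -sum_triangle -big_split/=; apply: eq_big_nat => i /andP[_ iN].
by rewrite -big_cat_nat//= leq_subr.
Qed.

End TriangleSum.

Lemma le_norm_corner_sum {R : numDomainType} (g b : nat -> nat -> R) N :
  (forall i j, `|g i j| <= b i j) -> `|corner_sum g N| <= corner_sum b N.
Proof.
move=> gb; apply: le_trans (ler_norm_sum _ _ _) _; apply: ler_sum => i _.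
by apply: le_trans (ler_norm_sum _ _ _) _; apply: ler_sum => j _.
Qed.

(** * Cauchy products of scalar exponential series *)

Section ExpCoefficients.
Context {R : realType}.

(** The binomial theorem divided by n!. *)
Lemma exp_coeffD (x y : R) n :
  \sum_(0 <= i < n.+1) exp_coeff x i * exp_coeff y (n - i)%N =
  exp_coeff (x + y) n.
Proof.
rewrite /exp_coeff /= addrC exprDn mulr_suml big_mkord.
apply: eq_bigr => i _; have /(congr1 (fun k => k%:R : R)) := bin_fact (leq_ord i).
rewrite !natrM => <-; field.
by rewrite !pnatr_eq0 -!lt0n bin_gt0 !fact_gt0 /= -ltnS ltn_ord.
Qed.

(** By [sum_square] the corner is the square of a partial sum of exp K minus a partial sum of
    exp(2K), and both have the same limit. *)
Lemma corner_sum_exp_coeff (K : R) :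
  ((corner_sum (fun i j => exp_coeff K i * exp_coeff K j) N)
    @[N --> \oo] --> 0)%classic.
Proof.
have -> : corner_sum (fun i j => exp_coeff K i * exp_coeff K j) =
  (fun N => series (exp_coeff K) N * series (exp_coeff K) N -
            series (exp_coeff (K + K)) N).
  apply/funext => N; apply/eqP; rewrite eq_sym subr_eq addrC; apply/eqP.
  have -> : series (exp_coeff K) N * series (exp_coeff K) N =
    \sum_(0 <= i < N) \sum_(0 <= j < N) exp_coeff K i * exp_coeff K j.
    by rewrite /series/= mulr_suml; apply: eq_bigr => i _; rewrite mulr_sumr.
  by rewrite sum_square; congr (_ + _); apply: eq_bigr => m _; rewrite exp_coeffD.
have -> : 0 = expR K * expR K - expR (K + K) :> R by rewrite -expRD subrr.
by apply: cvgB; [apply: cvgM|]; apply: is_cvg_series_exp_coeff.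
Qed.

End ExpCoefficients.

(** * Entrywise limits of matrix sequences *)

Section MatrixSequences.
Context {R : realType}.
Local Open Scope classical_set_scope.

Lemma cvg_mxP (m n : nat) (u : nat -> 'M[R]_(m, n)) (l : 'M[R]_(m, n)) :
  u @ \oo --> l <-> forall i j, u N i j @[N --> \oo] --> l i j.
Proof.
split=> [ul i j|ul].
  apply/cvg_entourageP => A entA.
  have uA := (cvg_mx_entourageP _ _ _ _ _ _).1 ul A entA.
  case: uA => N0 _ uA; exists N0 => // N /uA /(_ i j) /=.
  by rewrite inE.
apply/cvg_mx_entourageP => A entA.
apply: filter_forall => i; apply: filter_forall => j.
have uA := (cvg_entourageP _ _).1 (ul i j) A entA.
case: uA => N0 _ uA; exists N0 => // N /uA AN /=.
by rewrite inE.
Qed.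

Lemma cvg_mx_unique (m n : nat) (u : nat -> 'M[R]_(m, n)) (A B : 'M[R]_(m, n)) :
  u @ \oo --> A -> u @ \oo --> B -> A = B.
Proof.
move=> /cvg_mxP uA /cvg_mxP uB; apply/matrixP => i j.
by apply: cvg_unique (uA i j) (uB i j); exact: norm_hausdorff.
Qed.

Lemma cvg_mulmx (m n p : nat) (u : nat -> 'M[R]_(m, n)) (v : nat -> 'M[R]_(n, p))
    (A : 'M[R]_(m, n)) (B : 'M[R]_(n, p)) :
  u @ \oo --> A -> v @ \oo --> B -> u N *m v N @[N --> \oo] --> A *m B.
Proof.
move=> /cvg_mxP uA /cvg_mxP vB; apply/cvg_mxP => i j.
under eq_fun do rewrite mxE.
rewrite mxE; apply: cvg_big => [|r _]; first exact: add_continuous.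
exact: cvgM.
Qed.

Lemma cvg_trmx (m n : nat) (u : nat -> 'M[R]_(m, n)) (A : 'M[R]_(m, n)) :
  u @ \oo --> A -> (u N)^T @[N --> \oo] --> A^T.
Proof.
move=> /cvg_mxP uA; apply/cvg_mxP => i j.
by under eq_fun do rewrite mxE; rewrite mxE; exact: uA.
Qed.

End MatrixSequences.

(** * Matrix power series and their products *)

Section MatrixPowerSeries.
Context {R : realType} {d : nat}.
Implicit Types (a b : nat -> R) (M B : 'M[R]_d).
Local Open Scope classical_set_scope.

Definition mxseries a M : nat -> 'M[R]_d := series (fun j => a j *: M ^+ j).

(** Domination by the coefficients of exp makes the series converge at every matrix; the series of
    exp and phi both qualify. *)
Definition exp_bounded a := forall j, `|a j| <= j`!%:R^-1.

(** The sum [K] of all absolute entries dominates each absolute row sum, which closes the induction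
    on the power. *)
Lemma expr_coord_bound M :
  exists2 K : R, 0 <= K & forall j p q, `|(M ^+ j) p q| <= K ^+ j.
Proof.
pose K := \sum_p \sum_q `|M p q|.
have K0 : 0 <= K by apply: sumr_ge0 => p _; exact: sumr_ge0.
exists K => //; elim=> [|j IH] p q.
  by rewrite !expr0 mxE; case: eqP; rewrite /= ?normr1 ?normr0.
rewrite !exprS mxE; apply: le_trans (ler_norm_sum _ _ _) _.
apply: (@le_trans _ _ (\sum_r `|M p r| * K ^+ j)).
  by apply: ler_sum => r _; rewrite normrM ler_wpM2l.
rewrite -mulr_suml ler_wpM2r ?exprn_ge0// /K [leRHS](bigD1 p)//= lerDl.
by apply: sumr_ge0 => p' _; exact: sumr_ge0.
Qed.

Lemma mxseriesE a M N p q :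
  mxseries a M N p q = series (fun j => a j * (M ^+ j) p q) N.
Proof.
by rewrite /mxseries /series/= summxE; apply: eq_bigr => j _; rewrite mxE.
Qed.

Lemma is_cvg_mxseries a M : exp_bounded a -> cvgn (mxseries a M).
Proof.
move=> aB; have [K K0 MK] := expr_coord_bound M.
apply/cvg_ex; exists (\matrix_(p, q) limn (series (fun j => a j * (M ^+ j) p q))).
apply/cvg_mxP => p q; under eq_fun do rewrite mxseriesE.
rewrite mxE; suff : cvgn (series (fun j => a j * (M ^+ j) p q)) by [].
apply: normed_cvg; apply: series_le_cvg (is_cvg_series_exp_coeff K) => //= j.
- by rewrite /exp_coeff/= mulr_ge0 ?exprn_ge0.
- by rewrite normrM mulrC ler_pM.
Qed.

Lemma cvg_mxseries a M : exp_bounded a ->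
  mxseries a M @ \oo --> limn (mxseries a M).
Proof. exact: is_cvg_mxseries. Qed.

Definition convolution a b (m : nat) := \sum_(0 <= i < m.+1) a i * b (m - i)%N.

(* The entries of what the Cauchy product misses are dominated by the same
   remainder for the scalar product [expR K * expR K]. *)
Lemma cvg_mxseries_convolution a b M : exp_bounded a -> exp_bounded b ->
  mxseries (convolution a b) M @ \oo -->
  limn (mxseries a M) *m limn (mxseries b M).
Proof.
move=> aB bB; have [K K0 MK] := expr_coord_bound M.
pose g i j := (a i * b j) *: M ^+ (i + j).
have prodE N : mxseries a M N *m mxseries b M N =
    mxseries (convolution a b) M N + corner_sum g N.
  transitivity (\sum_(0 <= i < N) \sum_(0 <= j < N) g i j).
    rewrite /mxseries /series/= mulmx_suml; apply: eq_bigr => i _.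
    rewrite mulmx_sumr; apply: eq_bigr => j _.
    by rewrite -scalemxAl -scalemxAr scalerA /g exprD.
  rewrite sum_square; congr (_ + _); rewrite /mxseries /series/=.
  apply: eq_bigr => m _; rewrite /convolution scaler_suml.
  by apply: eq_big_nat => i /andP[_ im]; rewrite /g subnKC.
have -> : mxseries (convolution a b) M =
    fun N => mxseries a M N *m mxseries b M N - corner_sum g N.
  by apply/funext => N; rewrite prodE addrK.
rewrite -[X in _ --> X]subr0; apply: cvgB.
  by apply: cvg_mulmx; exact: cvg_mxseries.
apply/cvg_mxP => p q; rewrite mxE.
have cornerE N : corner_sum g N p q =
    corner_sum (fun i j => a i * b j * (M ^+ (i + j)) p q) N.
  rewrite /corner_sum summxE; apply: eq_bigr => i _.
  by rewrite summxE; apply: eq_bigr => j _; rewrite mxE.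
under eq_fun do rewrite cornerE.
apply/norm_cvg0P.
apply: (squeeze_cvgr _ (cvg_cst 0) (corner_sum_exp_coeff K)).
apply: nearW => N /=; rewrite normr_ge0 le_norm_corner_sum// => i j.
have -> : exp_coeff K i * exp_coeff K j = i`!%:R^-1 * j`!%:R^-1 * K ^+ (i + j).
  by rewrite /exp_coeff/= exprD; ring.
by rewrite !normrM !ler_pM ?mulr_ge0.
Qed.

(** With the sign moved into the coefficients, a product of series at -M and M becomes a Cauchy
    product at the single matrix [M]. *)
Lemma mxseries_oppr a M : mxseries a (- M) = mxseries (fun j => (-1) ^+ j * a j) M.
Proof.
apply/funext => N; apply: eq_bigr => j _.
rewrite mulrC -scalerA; congr (_ *: _).
elim: j => [|j IH]; first by rewrite !expr0 scale1r.
by rewrite !exprS IH -[LHS]/(_ *m _) mulNmx -scalemxAr -scaleN1r scalerA.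
Qed.

Lemma limn_mxseriesC a M B : exp_bounded a -> M *m B = B *m M ->
  limn (mxseries a M) *m B = B *m limn (mxseries a M).
Proof.
move=> aB MB.
have aM : mxseries a M @ \oo --> _ := @cvg_mxseries a M aB.
have cB : (fun=> B) @ \oo --> B by exact: cvg_cst.
apply: (@cvg_mx_unique _ _ _ (fun N => mxseries a M N *m B)).
  exact: (cvg_mulmx aM cB).
rewrite (_ : (fun N => _) = fun N => B *m mxseries a M N); first exact: cvg_mulmx.
apply/funext => N.
rewrite /mxseries /series/= mulmx_suml mulmx_sumr; apply: eq_bigr => j _.
rewrite -scalemxAl -scalemxAr; congr (_ *: _).
exact/esym/(commrX j (esym MB : GRing.comm B M)).
Qed.

(** Term by term, the hypothesis gives (M^T)^j B = B (-M)^j. It is applied with [B] equal to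
    [J k]. *)
Lemma limn_mxseries_trmx a M B : exp_bounded a -> M^T *m B = - (B *m M) ->
  (limn (mxseries a M))^T *m B = B *m limn (mxseries a (- M)).
Proof.
move=> aB MB; have cB : (fun=> B) @ \oo --> B by exact: cvg_cst.
have aM : mxseries a M @ \oo --> _ := @cvg_mxseries a M aB.
have aNM : mxseries a (- M) @ \oo --> _ := @cvg_mxseries a (- M) aB.
apply: (@cvg_mx_unique _ _ _ (fun N => (mxseries a M N)^T *m B)).
  exact: (cvg_mulmx (cvg_trmx aM) cB).
rewrite (_ : (fun N => _) = fun N => B *m mxseries a (- M) N).
  exact: cvg_mulmx.
apply/funext => N.
rewrite /mxseries /series/= (raddf_sum (@trmx R d d)) mulmx_suml mulmx_sumr.
apply: eq_bigr => j _ /=.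
have -> : (a j *: M ^+ j)^T = a j *: (M ^+ j)^T by apply/matrixP => ? ?; rewrite !mxE.
rewrite -scalemxAl -scalemxAr; congr (_ *: _).
elim: j => [|j IH]; first by rewrite !expr0 trmx1 mulmx1 mul1mx.
rewrite [in LHS]exprSr trmx_mul -mulmxA IH mulmxA MB.
by rewrite exprS -[X in _ = _ *m X]/(- M *m (- M) ^+ j) [RHS]mulmxA mulmxN.
Qed.

Lemma exp_bounded_sign a : exp_bounded a -> exp_bounded (fun j => (-1) ^+ j * a j).
Proof. by move=> aB j; rewrite normrM normrX normrN1 expr1n mul1r. Qed.

Definition exp_coef (j : nat) : R := j`!%:R^-1.
Definition phi_coef (j : nat) : R := j.+1`!%:R^-1.

Lemma exp_bounded_exp_coef : exp_bounded exp_coef.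
Proof. by move=> j; rewrite /exp_coef ger0_norm. Qed.

Lemma exp_bounded_phi_coef : exp_bounded phi_coef.
Proof.
move=> j; rewrite /phi_coef ger0_norm// lef_pV2 ?posrE ?ltr0n ?fact_gt0//.
by rewrite ler_nat factS leq_pmull.
Qed.

(** By [exp_coeffD], the m-th coefficient of the product is (1 - 1)^m / m!. *)
Lemma limn_mxseries_exp_inv M :
  limn (mxseries exp_coef (- M)) *m limn (mxseries exp_coef M) = 1%:M.
Proof.
have bE := exp_bounded_exp_coef.
rewrite mxseries_oppr; apply: cvg_mx_unique.
  by apply: cvg_mxseries_convolution => //; exact: exp_bounded_sign.
(* The empty partial sum is 0 and all later ones are 1, hence the index shift. *)
rewrite -(cvg_shiftS (mxseries _ M)) (_ : (fun _ => _) = cst 1%:M); first exact: cvg_cst.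
apply/funext => N /=; rewrite /mxseries /series/= big_nat_recl//= big1_seq => [|j _].
  rewrite addr0 /convolution big_nat1 /exp_coef expr0 fact0.
  by rewrite invr1 !mulr1 scale1r expr0.
rewrite (_ : convolution _ _ _ = 0) ?scale0r//.
have := exp_coeffD (-1 : R) 1 j.+1.
rewrite addNr /exp_coeff/= expr0n mul0r => <-.
by apply: eq_bigr => i _; rewrite expr1n mul1r.
Qed.

(** The sum for (1 - 1)^(m+1) / (m+1)! in [exp_coeffD] vanishes. Its term of index 0 is 1/(m+1)!,
    and the others add up to minus the m-th coefficient of the product. *)
Lemma limn_mxseries_phi_exp M :
  limn (mxseries phi_coef (- M)) *m limn (mxseries exp_coef M) =
  limn (mxseries phi_coef M).
Proof.
have bE := exp_bounded_exp_coef; have bP := exp_bounded_phi_coef.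
rewrite mxseries_oppr; apply: cvg_mx_unique.
  by apply: cvg_mxseries_convolution => //; exact: exp_bounded_sign.
rewrite (_ : mxseries _ M = mxseries phi_coef M); first exact: cvg_mxseries.
congr mxseries; apply/funext => m; apply/eqP; rewrite -subr_eq0 -oppr_eq0 opprB.
apply/eqP; have := exp_coeffD (-1 : R) 1 m.+1.
rewrite addNr /exp_coeff/= expr0n mul0r => <-.
rewrite big_nat_recl//= /convolution -sumrN expr0 expr1n fact0 subn0 divr1.
rewrite !mul1r /phi_coef; congr (_ + _); apply: eq_bigr => i _.
by rewrite exprS expr1n !mul1r subSS /exp_coef; ring.
Qed.

(** Multiplication by [M] shifts the series of phi onto that of exp without its constant term, so
    [N] terms on one side match [N.+1] on the other. *)
Lemma mulmx_limn_mxseries_phi M :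
  M *m limn (mxseries phi_coef M) = limn (mxseries exp_coef M) - 1%:M.
Proof.
have aM : mxseries phi_coef M @ \oo --> _ :=
  @cvg_mxseries phi_coef M exp_bounded_phi_coef.
have eM : mxseries exp_coef M @ \oo --> _ :=
  @cvg_mxseries exp_coef M exp_bounded_exp_coef.
have cM : (fun=> M) @ \oo --> M by exact: cvg_cst.
apply: (@cvg_mx_unique _ _ _ (fun N => M *m mxseries phi_coef M N)).
  exact: (cvg_mulmx cM aM).
rewrite (_ : (fun N => _) = fun N => mxseries exp_coef M N.+1 - 1%:M).
  apply: cvgB; last exact: cvg_cst.
  by rewrite (cvg_shiftS (mxseries exp_coef M)).
apply/funext => N; rewrite /mxseries /series/= [X in _ = X - _]big_nat_recl//=.
rewrite /exp_coef fact0 invr1 scale1r expr0 addrAC subrr add0r mulmx_sumr.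
apply: eq_bigr => j _; rewrite -scalemxAr; congr (_ *: _).
by rewrite exprS.
Qed.

End MatrixPowerSeries.

(** * Taylor coefficients of phi at 0, from its integral definition *)

Section PhiDerivatives.
Context {R : realType}.
Local Open Scope classical_set_scope.

(* Coefficients of the [k]-th derivative of [\sum_i x^i / (i+1)!]. *)
Definition phi_derive_coef (k i : nat) : R := i`!%:R^-1 * (i + k.+1)%:R^-1.

(** Termwise differentiation only raises [k], since (i+1) / (i+1)! = 1/i!. *)
Lemma pseries_diffs_phi k :
  pseries_diffs (phi_derive_coef k) = phi_derive_coef k.+1.
Proof.
apply/funext => i; rewrite /pseries_diffs /phi_derive_coef factS natrM addSnnS.
by rewrite invfM !mulrA mulfV ?pnatr_eq0// mul1r.
Qed.

Lemma is_cvg_pseries_phi k (x : R) : cvgn (pseries (phi_derive_coef k) x).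
Proof.
apply: normed_cvg; apply: series_le_cvg (is_cvg_series_exp_coeff `|x|) => //= j.
  by rewrite /exp_coeff/= mulr_ge0 ?exprn_ge0.
rewrite normrM normrX /exp_coeff/= [leRHS]mulrC ler_wpM2r ?exprn_ge0//.
rewrite /phi_derive_coef ger0_norm ?mulr_ge0// ler_piMr//.
by rewrite addnS invf_le1 ?ltr0n ?ler1n.
Qed.

Lemma limn_pseries0 (c : R^nat) : limn (pseries c 0) = c 0%N.
Proof.
apply/cvg_lim => //; rewrite -cvg_shiftS (_ : (fun _ => _) = cst (c 0%N)).
  exact: cvg_cst.
apply/funext => n /=; rewrite /pseries /series/= big_nat_recl//= expr0 mulr1.
by rewrite big1 ?addr0// => i _; rewrite expr0n mulr0.
Qed.

Lemma mulr_limn_pseries_phi (x : R) :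
  x * limn (pseries (phi_derive_coef 0) x) = expR x - 1.
Proof.
have pC := @is_cvg_pseries_phi 0 x.
apply: (@cvg_unique _ _ ((fun n => x * pseries (phi_derive_coef 0) x n) @ \oo)).
- exact: norm_hausdorff.
- by apply: cvgM => //; exact: cvg_cst.
rewrite (_ : (fun n => _) = fun n => series (exp_coeff x) n.+1 - 1).
  apply: cvgB; last exact: cvg_cst.
  by rewrite (cvg_shiftS (series (exp_coeff x))); exact: is_cvg_series_exp_coeff.
apply/funext => n; rewrite /pseries /series/= [X in _ = X - _]big_nat_recl//=.
rewrite /exp_coeff/= fact0 expr0 divr1 addrAC subrr add0r mulr_sumr.
apply: eq_bigr => i _; rewrite /phi_derive_coef addn1 factS natrM exprS invfM.
by ring.
Qed.

(** For nonzero [x] the integral is computed from the antiderivative e^(tx)/x; at 0, where this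
    fails, the integrand is constantly 1. *)
Lemma phi_pseries : phi = fun x : R => limn (pseries (phi_derive_coef 0) x).
Proof.
apply/funext => x; have [->|x0] := eqVneq x 0.
  rewrite limn_pseries0 /phi_derive_coef /phi.
  under eq_Rintegral do rewrite mulr0 expR0.
  rewrite Rintegral_cst//= lebesgue_measure_itv/= lte_fin ltr01.
  by rewrite oppr0 adde0/= invr1.
apply: (mulfI x0); rewrite mulr_limn_pseries_phi /phi /Rintegral.
have dF (t : R) : is_derive t 1 (fun t => x^-1 * expR (t * x)) (expR (t * x)).
  apply: trigger_derive.
  by rewrite /GRing.scale/=; field.
have ce : continuous (fun t : R => expR (t * x)).
  move=> t; apply: continuous_comp; last exact: continuous_expR.
  by apply: cvgM; [exact: cvg_id|exact: cvg_cst].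
have cF (t : R) : x^-1 * expR (s * x) @[s --> t] --> x^-1 * expR (t * x).
  by apply: cvgM; [exact: cvg_cst|exact: ce].
rewrite (@continuous_FTC2 _ _ (fun t => x^-1 * expR (t * x)))//=.
- rewrite mul0r mul1r expR0; field => //.
- exact: continuous_subspaceT.
- split=> [t _||]; first by have [] := dF t.
  + by apply: cvg_at_right_filter; exact: cF.
  + by apply: cvg_at_left_filter; exact: cF.
- by move=> t _; rewrite derive1E; have [] := dF t.
Qed.

Lemma derive1n_phi k :
  derive1n k phi = fun x : R => limn (pseries (phi_derive_coef k) x).
Proof.
elim: k => [|k IH]; first by rewrite derive1n0 phi_pseries.
apply/funext => x; rewrite derive1nS IH derive1E -pseries_diffs_phi.
(* Any radius beyond |x| serves, as the series converge on all of R. *)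
apply: derive_val; apply: (@pseries_snd_diffs _ _ (`|x| + 1)).
- exact: is_cvg_pseries_phi.
- by rewrite pseries_diffs_phi; exact: is_cvg_pseries_phi.
- by rewrite !pseries_diffs_phi; exact: is_cvg_pseries_phi.
- by rewrite [ltRHS]ger0_norm ?ltrDl// addr_ge0.
Qed.

Lemma derive1n_expR k : derive1n k (@expR R) = expR.
Proof.
elim: k => [|k IH]; first by rewrite derive1n0.
by apply/funext => x; rewrite derive1nS IH derive1E; exact: derive_val.
Qed.

Lemma expmxE d (M : 'M[R]_d) : expmx M = limn (mxseries exp_coef M).
Proof.
rewrite /expmx /mxfun (_ : (fun j => _) = fun j => exp_coef j *: M ^+ j)//.
by apply/funext => j; rewrite derive1n_expR expR0 mul1r.
Qed.

(** The j-th derivative of phi at 0 is 1/(j+1), so its Taylor coefficient is 1/(j+1)!. *)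
Lemma phimxE d (M : 'M[R]_d) : phimx M = limn (mxseries phi_coef M).
Proof.
rewrite /phimx /mxfun (_ : (fun j => _) = fun j => phi_coef j *: M ^+ j)//.
apply/funext => j; rewrite derive1n_phi limn_pseries0 /phi_derive_coef.
by rewrite /phi_coef fact0 invr1 mul1r factS natrM invfM mulrC.
Qed.

End PhiDerivatives.

(** * The Euclidean inner product *)

Section Dot.
Context {R : realType} {d : nat}.
Implicit Types (u v w : 'cV[R]_d) (t : R).

Definition dot u v : R := (u^T *m v) 0 0.

Lemma dotC u v : dot u v = dot v u.
Proof. by rewrite /dot -(trmxK (u^T *m v)) trmx_mul trmxK mxE. Qed.

Lemma dotDr u v w : dot u (v + w) = dot u v + dot u w.
Proof. by rewrite /dot mulmxDr mxE. Qed.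

Lemma dotZr t u v : dot u (t *: v) = t * dot u v.
Proof. by rewrite /dot -scalemxAr mxE. Qed.

Lemma dot0l v : dot 0 v = 0.
Proof. by rewrite /dot trmx0 mul0mx mxE. Qed.

Lemma dotDl u v w : dot (u + v) w = dot u w + dot v w.
Proof. by rewrite dotC dotDr !(dotC w). Qed.

Lemma dotZl t u v : dot (t *: u) v = t * dot u v.
Proof. by rewrite dotC dotZr dotC. Qed.

Lemma dot_delta i u : dot u (delta_mx i 0) = u i 0.
Proof.
rewrite /dot mxE (bigD1 i)//= !mxE !eqxx mulr1 big1 ?addr0// => j ji.
by rewrite !mxE (negPf ji) mulr0.
Qed.

End Dot.

Lemma dot_mulmx {R : realType} (m n : nat) (A : 'M[R]_(m, n)) u v :
  dot u (A *m v) = dot (A^T *m u) v.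
Proof. by rewrite /dot trmx_mul trmxK mulmxA. Qed.

(** * Functions with affine gradient are quadratic polynomials *)

Section AffineGradient.
Context {R : realType} {d : nat}.
Variables (g : 'cV[R]_d -> R) (S : 'M[R]_d) (b : 'cV[R]_d).
Hypothesis g_derivable : forall (i : 'I_d) x, derivable g x (delta_mx i 0).
Hypothesis g_gradient : forall x, gradient g x = S *m x + b.

Let is_derive_line (x : 'cV[R]_d) (i : 'I_d) (t : R) :
  is_derive t 1 (fun t => g (x + t *: delta_mx i 0))
    ((S *m (x + t *: delta_mx i 0) + b) i 0).
Proof.
set e := delta_mx i 0.
have diffqE : (fun h : R => h^-1 *: (g (x + (h *: (1 : R) + t) *: e) - g (x + t *: e)))
    = (fun h => h^-1 *: (g (h *: e + (x + t *: e)) - g (x + t *: e))).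
  apply/funext => h; congr (_ *: (g _ - _)).
  by rewrite [h *: 1]mulr1 scalerDl addrCA addrA.
have dg : derivable g (x + t *: e) e by exact: g_derivable.
apply: DeriveDef.
  by rewrite /derivable diffqE; exact: dg.
by rewrite /derive diffqE -g_gradient mxE.
Qed.

(** Along a coordinate axis the derivative of [g] is affine in [t], so the expansion stops at order
    two. *)
Let line (x : 'cV[R]_d) (i : 'I_d) (t : R) :
  g (x + t *: delta_mx i 0) =
  g x + t * (S *m x + b) i 0 + 2^-1 * t ^+ 2 * S i i.
Proof.
set e := delta_mx i 0.
pose f (t : R) := g (x + t *: e) - (t * (S *m x + b) i 0 + 2^-1 * t ^+ 2 * S i i).
have df (s : R) : is_derive s 1 f 0.
  have dl := is_derive_line x i s.
  have -> : 0 = (S *m (x + s *: e) + b) i 0 -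
      ((S *m x + b) i 0 + s * S i i) :> R.
    have -> : s * S i i = (S *m (s *: e)) i 0.
      rewrite -scalemxAr mxE; congr (_ * _).
      by rewrite -colE mxE.
    by rewrite mulmxDr !mxE; ring.
  apply: is_deriveB; apply: trigger_derive.
  by rewrite /GRing.scale/=; field.
have := @is_derive_0_is_cst _ f t 0 df.
rewrite /f scale0r addr0 mul0r expr0n/= mulr0 mul0r addr0 subr0 => <-.
by ring.
Qed.

(* Integrate [g] along two sides of a unit square, in both orders. *)
Lemma affine_gradient_sym : S^T = S.
Proof.
apply/matrixP => i j; rewrite mxE.
have gE k l : g (0 + 1 *: delta_mx k 0 + 1 *: delta_mx l 0) =
    g 0 + b k 0 + b l 0 + S l k + 2^-1 * (S k k + S l l).
  rewrite !line scale1r !add0r mulmx0 -colE !mxE; ring.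
have := gE i j; rewrite addrAC gE; lra.
Qed.

(** The difference [D] is constant along every coordinate axis, and [x] is reached from 0 by adding
    one coordinate at a time. *)
Lemma affine_gradient_quadratic x :
  g x = g 0 + dot x b + 2^-1 * dot x (S *m x).
Proof.
pose D y := g y - (dot y b + 2^-1 * dot y (S *m y)).
have Dline y i t : D (y + t *: delta_mx i 0) = D y.
  have dE : dot y (S *m delta_mx i 0) = (S *m y) i 0.
    by rewrite dot_mulmx affine_gradient_sym dot_delta.
  rewrite /D line !mulmxDr -scalemxAr !(dotDl, dotDr, dotZl, dotZr) dE.
  rewrite !(dotC (delta_mx i 0)) !dot_delta -colE !mxE.
  by field.
have D0 s : D (\sum_(i <- s) x i 0 *: delta_mx i 0) = D 0.
  by elim: s => [|k s IH]; rewrite ?big_nil// big_cons addrC Dline.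
have xE : x = \sum_(i <- index_enum 'I_d) x i 0 *: delta_mx i 0.
  rewrite {1}[x]matrix_sum_delta; apply: eq_bigr => i _.
  by rewrite big_ord1.
have := D0 (index_enum 'I_d); rewrite -xE /D.
rewrite !dot0l; lra.
Qed.

End AffineGradient.

(** * Skew-symmetry and square of the matrix J *)

Section Symplectic.
Context {R : realType} {k : nat}.

Lemma mulJJ : J k *m J k = - 1%:M :> 'M[R]_(k + k).
Proof.
rewrite /J mulmx_block !mul0mx !mulmx0 !mulmx1 !mul1mx.
by rewrite !add0r !addr0 scalar_mx_block opp_block_mx !oppr0.
Qed.

Lemma unitmx_J : (J k : 'M[R]_(k + k)) \in unitmx.
Proof.
have JN : J k *m - J k = 1%:M :> 'M[R]_(k + k) by rewrite mulmxN mulJJ opprK.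
by case: (mulmx1_unit JN).
Qed.

Lemma trmx_J : (J k)^T = - J k :> 'M[R]_(k + k).
Proof.
by rewrite /J tr_block_mx !trmx0 trmx1 raddfN /= trmx1 opp_block_mx !oppr0 opprK.
Qed.

Lemma dotJC (u v : 'cV[R]_(k + k)) : dot u (J k *m v) = - dot v (J k *m u).
Proof. by rewrite dot_mulmx trmx_J mulNmx -scaleN1r dotZl mulN1r dotC. Qed.

End Symplectic.

(** * Energy balance of the reduced system on R^{2k} *)

Section ReducedProblem.
Context {R : realType} {k : nat}.
Variables (F : 'M[R]_(k + k)) (h : R).
Hypothesis JF_sym : (J k *m F)^T = J k *m F.

Let M := h *: F.
Let E := expmx M.
Let P := phimx M.

(** [F] is a Hamiltonian matrix; this is the form of that fact which [limn_mxseries_trmx] takes. *)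
Let MJ : M^T *m J k = - (J k *m M).
Proof.
have := JF_sym; rewrite trmx_mul trmx_J mulmxN => /eqP.
rewrite eqr_oppLR => /eqP FJ.
by rewrite /M linearZ /= -scalemxAl FJ -scalemxAr scalerN.
Qed.

Lemma dotJ_expmx u v : dot (E *m u) (J k *m (E *m v)) = dot u (J k *m v).
Proof.
rewrite dotC dot_mulmx dotC !mulmxA.
have -> : E^T *m J k *m E = J k.
  rewrite /E expmxE limn_mxseries_trmx//; last exact: exp_bounded_exp_coef.
  by rewrite -mulmxA limn_mxseries_exp_inv mulmx1.
by [].
Qed.

Lemma dotJ_phimx_expmx u :
  dot (P *m u) (J k *m (E *m u)) = - dot (P *m u) (J k *m u).
Proof.
rewrite -[RHS]dotJC [LHS]dotC [LHS]dot_mulmx [LHS]dotC !mulmxA.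
have -> // : P^T *m J k *m E = J k *m P.
rewrite /P /E expmxE phimxE limn_mxseries_trmx//; last exact: exp_bounded_phi_coef.
by rewrite -mulmxA limn_mxseries_phi_exp.
Qed.

Lemma expmx_mulmxC : E *m F = F *m E.
Proof.
rewrite /E expmxE limn_mxseriesC//; first exact: exp_bounded_exp_coef.
by rewrite /M -scalemxAl -scalemxAr.
Qed.

Lemma mulmx_phimx : h *: (F *m P) = E - 1%:M.
Proof. by rewrite scalemxAl /P /E expmxE phimxE mulmx_limn_mxseries_phi. Qed.

(* Energy of the reduced linear system [y' = F y + g], relative to [y = 0]. *)
Definition energy (g v : 'cV[R]_(k + k)) : R :=
  dot v (J k *m g) + 2^-1 * dot v (J k *m (F *m v)).

(** The identity h F P g = E g - g removes [F] from the terms containing [P]. The terms pairing E w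
    and P g with J g then cancel, which leaves the energy at -w/2. *)
Lemma energy_midpoint g w :
  energy g (2^-1 *: (- (E *m w) + (2 * h) *: (P *m g))) = energy g (- 2^-1 *: w).
Proof.
have FP : h *: (F *m (P *m g)) = E *m g - g.
  by rewrite mulmxA scalemxAl mulmx_phimx mulmxBl mul1mx.
have FE : F *m (E *m w) = E *m (F *m w) by rewrite mulmxA -expmx_mulmxC mulmxA.
have JFC u v : dot u (J k *m (F *m v)) = dot v (J k *m (F *m u)).
  by rewrite !mulmxA dot_mulmx JF_sym dotC.
have -> : 2^-1 *: (- (E *m w) + (2 * h) *: (P *m g)) =
    - 2^-1 *: (E *m w) + h *: (P *m g).
  rewrite scalerDr scalerA mulrA mulVf ?pnatr_eq0// mul1r scaleNr scalerN.
  by [].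
have cross : h * dot (E *m w) (J k *m (F *m (P *m g))) =
    dot w (J k *m g) - dot (E *m w) (J k *m g).
  rewrite -dotZr scalemxAr FP mulmxBr dotDr -scaleN1r dotZr dotJ_expmx; ring.
(* Both parts of E g - g contribute the same amount, the first one through [dotJ_phimx_expmx]. *)
have quad : h * dot (P *m g) (J k *m (F *m (P *m g))) =
    - 2 * dot (P *m g) (J k *m g).
  rewrite -dotZr scalemxAr FP mulmxBr dotDr -scaleN1r dotZr dotJ_phimx_expmx; ring.
have homog : dot (E *m w) (J k *m (F *m (E *m w))) = dot w (J k *m (F *m w)).
  by rewrite FE dotJ_expmx.
rewrite /energy !mulmxDr -!scalemxAr !(dotDl, dotDr, dotZl, dotZr).
rewrite (JFC (P *m g) (E *m w)) homog.
(* This arrangement exposes the left sides of [cross] and [quad]; the square of [h] is split for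
   that. *)
transitivity (- 2^-1 * dot (E *m w) (J k *m g) + h * dot (P *m g) (J k *m g) +
  2^-1 * (2^-1 * 2^-1 * dot w (J k *m (F *m w)) -
    h * dot (E *m w) (J k *m (F *m (P *m g))) +
    h * (h * dot (P *m g) (J k *m (F *m (P *m g)))))); first by field.
by rewrite cross quad; field.
Qed.

End ReducedProblem.

(** * Reduction of the projected scheme to the reduced system *)

Unset Implicit Arguments.

Theorem theorem3 (R : realType) (n k : nat) (n_gt0 : (0 < n)%N)
    (k_gt0 : (0 < k)%N)
    (H : 'cV[R]_(n + n) -> R) (A : 'M[R]_(n + n)) (c : 'cV[R]_(n + n))
    (H_smooth : smooth H)
    (H_affine : forall y : 'cV[R]_(n + n), ham_field H y = A *m y + c)
    (U : 'M[R]_(n + n, k + k)) (U_symplectic : symplectic U)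
    (F : 'M[R]_(k + k)) (F_def : F = symp_inv U *m A *m U)
    (h : R) (xm x : 'cV[R]_(n + n))
    (x_range : exists w : 'cV[R]_(k + k), x - xm = U *m w)
    (xp : 'cV[R]_(n + n))
    (xp_def : xp = x + U *m expmx (h *: F) *m symp_inv U *m (xm - x)
                   + (2 * h) *: (U *m phimx (h *: F) *m symp_inv U
                                   *m ham_field H x)) :
  H (2^-1 *: (xp + x)) = H (2^-1 *: (x + xm)).
Proof.
have [w xw] := x_range.
have JU : symp_inv U *m U = 1%:M.
  have US : U^T *m J n *m U = J k := U_symplectic.
  by rewrite /symp_inv -!mulmxA [U^T *m _]mulmxA US mulVmx ?unitmx_J.
have JUinv : J k *m symp_inv U = U^T *m J n.
  by rewrite /symp_inv !mulmxA mulmxV ?unitmx_J// mul1mx.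
(* The symplectic inverse is abstracted to [V], with V U = 1 and J_k V = U^T J_n. *)
move: (symp_inv U) JU JUinv F_def xp_def => V VU JV F_def xp_def.
have grad y : gradient H y = (J n *m A) *m y + J n *m c.
  by rewrite -mulmxA -mulmxDr -H_affine /ham_field mulmxA mulmxV ?unitmx_J// mul1mx.
have dH i y : derivable H y (delta_mx i 0).
  by have [_ +  _] := H_smooth 1%N; apply.
(* [J n *m A] is the Hessian of [H]; its symmetry descends to J_k F = U^T (J_n A) U. *)
have S_sym := affine_gradient_sym dH grad.
have JFE : J k *m F = U^T *m (J n *m A) *m U.
  by rewrite F_def !mulmxA JV.
have JF_sym : (J k *m F)^T = J k *m F.
  by rewrite JFE !trmx_mul trmxK -trmx_mul S_sym !mulmxA.
pose g := V *m ham_field H x.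
(* The linear coefficient is U^T J_n f(x) = J_k g, and the quadratic form has matrix U^T J_n A U =
   J_k F. *)
have HU v : H (x + U *m v) = H x + energy F g v.
  have UT y : dot v (U^T *m y) = dot (U *m v) y by rewrite dot_mulmx trmxK.
  have SC y z : dot y (J n *m A *m z) = dot z (J n *m A *m y).
    by rewrite dot_mulmx S_sym dotC.
  rewrite (affine_gradient_quadratic dH grad (x + _)).
  rewrite (affine_gradient_quadratic dH grad x).
  rewrite /energy /g [J k *m (V *m _)]mulmxA JV H_affine.
  rewrite [J k *m (F *m v)]mulmxA JFE -![U^T *m _ *m _]mulmxA !UT.
  rewrite [J n *m (A *m x + c)]mulmxDr [J n *m (A *m x)]mulmxA.
  rewrite [J n *m A *m (x + _)]mulmxDr !(dotDl, dotDr) (SC x (U *m v)).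
  rewrite -[J n *m A *m U *m v]mulmxA; by field.
have xx : 2^-1 *: (x + x) = x.
  by rewrite -mulr2n -[x *+ 2]scaler_nat scalerA mulVf ?pnatr_eq0// scale1r.
have -> : 2^-1 *: (x + xm) = x + U *m (- 2^-1 *: w).
  have -> : xm = x - U *m w by rewrite -xw subKr.
  by rewrite -scalemxAr addrA scalerBr xx scaleNr.
(* Since V U = 1, applying [V] to x_- - x gives -w. *)
have -> : 2^-1 *: (xp + x) =
    x + U *m (2^-1 *: (- (expmx (h *: F) *m w) + (2 * h) *: (phimx (h *: F) *m g))).
  have xmx : xm - x = - (U *m w) by rewrite -xw opprB.
  have VUw : V *m (U *m w) = w by rewrite mulmxA VU mul1mx.
  rewrite xp_def xmx -!mulmxA mulmxN VUw -/g !mulmxN -scalemxAr mulmxDr mulmxN.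
  by rewrite -scalemxAr -[x + _ + _]addrA addrAC scalerDr xx.
by rewrite !HU energy_midpoint.
Qed.
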